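(* (Fubini's theorem.) Let $\pi:\mathsf A\to\mathsf B$ be a finite covering of discrete groupoids with finite homs, and let $\varphi:\mathsf A\to V$ be an integrable morphism. Then $$\int_{\mathcal B}\pi_*\varphi\,d\mu_{\mathcal B}=\int_{\mathcal A}\varphi\,d\mu_{\mathcal A},$$ where $\pi_*\varphi:\mathsf B\to V$ is the push-forward of $\varphi$, defined by $(\pi_*\varphi)(y)=\sum_{x\in\mathrm{Ob}(\mathsf A),\ \pi(x)=y}\varphi(x)$.
   Context: A groupoid is a small category in which all morphisms are isomorphisms; it has finite homs if $\mathrm{Aut}\,x$ is finite for every object $x$. A discrete groupoid is a groupoid with the discrete topology. $\mathcal A$ denotes the set of isomorphism classes of objects of $\mathsf A$ (the coarse space), and similarly $\mathcal B$ for $\mathsf B$. The discrete measure on $\mathcal A$ is $\mu_{\mathcal A}([x])=1/|\mathrm{Aut}\,x|$. A functor $\pi:\mathsf A\to\mathsf B$ is a *covering* if for every morphism $f:y_1\to y_2$ in $\mathsf B$ and every object $x_1$ of $\mathsf A$ with $\pi(x_1)=y_1$ there is a unique morphism in $\mathsf A$ with source $x_1$ mapped by $\pi$ to $f$. It is *finite* if for every object $y$ of $\mathsf B$ the set $\{x\in\mathrm{Ob}(\mathsf A):\pi(x)=y\}$ is finite. Integrals are defined for discrete groupoids with finite homs and graded objects, i.e. equipped with a decomposition $\mathsf A\simeq\coprod_{n\in\mathbb N}\mathsf A_n$, such that the set $\mathcal A_n$ of isomorphism classes of objects of $\mathsf A_n$ is finite for every $n$; the groupoids over which one integrates are understood to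 be of this kind. $V$ is a topological module over a topological commutative unital $\mathbb C$-algebra $R$, regarded as a groupoid with only identity morphisms. A morphism $\varphi:\mathsf A\to V$ is thus a map on objects constant on isomorphism classes. It is *integrable* if the series $\sum_{n=0}^\infty\big(\sum_{[x]\in\mathcal A_n}\varphi(x)/|\mathrm{Aut}\,x|\big)$ converges in $V$; one then writes $\int_{\mathcal A}\varphi\,d\mu_{\mathcal A}=\sum_{[x]\in\mathcal A}\varphi(x)/|\mathrm{Aut}\,x|$ for its sum.
   Formalization: The covering π is additionally assumed to preserve the gradings (π maps objects of A_n to objects of B_n); with unrelated gradings on A and B the claim fails, since the identity of a discrete set could rearrange a conditionally convergent series. *)

(* Defs.v *)
From HB Require Import structures.
From mathcomp Require Import all_boot all_order all_algebra generic_quotient.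
From mathcomp Require Import finmap complex.
From mathcomp Require Import boolp classical_sets functions cardinality fsbigop.
From mathcomp Require Import reals topology normedtype sequences.

Set Implicit Arguments.
Unset Strict Implicit.
Unset Printing Implicit Defensive.

Import Order.TTheory GRing.Theory Num.Theory.
Import numFieldNormedType.Exports.

Local Open Scope classical_set_scope.
Local Open Scope ring_scope.

(* The library's [comAlgType] and [topologicalLmodType] are not general enough:
   the former excludes the zero algebra, and the latter only allows scalars in
   a [numDomainType].  Via [TopologicalLmodule], addition, opposite and scaling
   by the (normed) field [C] are continuous on a [topComAlgType C]. *)
HB.mixin Record isTopologicalAlgebra (C : numFieldType) R
    & Topological R & GRing.Algebra C R := {
  algebra_mul_continuous : continuous (fun z : R * R => z.1 * z.2)
}.

#[short(type="topComAlgType")]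
HB.structure Definition TopComAlgebra (C : numFieldType) :=
  {R of TopologicalLmodule C R & GRing.ComPzRing R & GRing.Algebra C R
      & isTopologicalAlgebra C R}.

(* Not an HB structure: one joining [Topological] and [GRing.Lmodule R] clashes
   with [NbhsLmodule], whose scalars are in a [numDomainType]. *)
Record topModType (C : numFieldType) (R : topComAlgType C) := TopModType {
  topmod_sort : topologicalZmodType;
  topmod_lmodule : GRing.Zmodule_isLmodule R topmod_sort;
  topmod_scale_continuous : continuous
    (fun z : R * topmod_sort => GRing.Zmodule_isLmodule.scale topmod_lmodule z.1 z.2)
}.

Definition topmod_carrier (C : numFieldType) (R : topComAlgType C)
  (V : topModType R) : Type := topmod_sort V.

Coercion topmod_carrier : topModType >-> Sortclass.

HB.instance Definition _ (C : numFieldType) (R : topComAlgType C)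
  (V : topModType R) := TopologicalZmodule.on (topmod_carrier V).
HB.instance Definition _ (C : numFieldType) (R : topComAlgType C)
  (V : topModType R) :=
  (topmod_lmodule V : GRing.Zmodule_isLmodule R (topmod_carrier V)).
HB.instance Definition _ (C : numFieldType) (R : topComAlgType C)
  (V : topModType R) := isPointed.Build (topmod_carrier V) 0.

(* Classically every type carries a [choiceType] structure, so asking for one
   on objects and morphisms is no restriction; it gives access to the library's
   sums over (finite) sets, cardinals and quotients. *)
Record groupoid := Groupoid {
  ob :> choiceType;
  hom : ob -> ob -> choiceType;
  idm : forall x, hom x x;
  hcomp : forall x y z, hom x y -> hom y z -> hom x z;
  hinv : forall x y, hom x y -> hom y x;
  hcomp_idl : forall x y (f : hom x y), hcomp (idm x) f = f;
  hcomp_idr : forall x y (f : hom x y), hcomp f (idm y) = f;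
  hcompA : forall x y z t (f : hom x y) (g : hom y z) (h : hom z t),
    hcomp f (hcomp g h) = hcomp (hcomp f g) h;
  hcomp_invr : forall x y (f : hom x y), hcomp f (hinv f) = idm x;
  hcomp_invl : forall x y (f : hom x y), hcomp (hinv f) f = idm y
}.

Arguments idm {_} x.

Definition Aut (A : groupoid) (x : A) : set (hom x x) := [set: hom x x].

Arguments Aut {_} x.

Definition finite_homs (A : groupoid) := forall x : A, finite_set (Aut x).

Definition card_Aut (A : groupoid) (x : A) : nat := #|` fset_set (Aut x)|%fset.

Definition isomorphic (A : groupoid) : rel A := fun x y => `[< inhabited (hom x y) >].

Lemma isomorphic_refl (A : groupoid) : reflexive (@isomorphic A).
Proof. by move=> x; apply/asboolP; exists; exact: idm. Qed.

Lemma isomorphic_sym (A : groupoid) : symmetric (@isomorphic A).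
Proof.
move=> x y; apply/idP/idP => /asboolP[f]; apply/asboolP; exists; exact: hinv f.
Qed.

Lemma isomorphic_trans (A : groupoid) : transitive (@isomorphic A).
Proof.
move=> y x z /asboolP[f] /asboolP[g]; apply/asboolP; exists; exact: hcomp f g.
Qed.

Canonical isomorphic_equiv (A : groupoid) :=
  EquivRel (@isomorphic A) (@isomorphic_refl A) (@isomorphic_sym A)
    (@isomorphic_trans A).

Definition coarse (A : groupoid) := {eq_quot @isomorphic A}%qT.

(* A decomposition of A as a coproduct of groupoids A_n amounts to a degree on
   objects that is constant along morphisms, A_n being the full subgroupoid on
   the objects of degree n. *)
Definition coarse_deg (A : groupoid) (deg : A -> nat) (n : nat) :
  set (coarse A) := [set c | deg (repr c) = n].

Record grading (A : groupoid) := Grading {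
  degree :> A -> nat;
  degree_hom : forall x y, hom x y -> degree x = degree y;
  coarse_finite : forall n, finite_set (coarse_deg degree n)
}.

Definition mor (A : groupoid) := {xy : A * A & hom xy.1 xy.2}.

Definition source (A : groupoid) (f : mor A) : A := (tag f).1.

Record gfunctor (A B : groupoid) := GFunctor {
  fob :> A -> B;
  fhom : forall x y, hom x y -> hom (fob x) (fob y);
  fhom_id : forall x, fhom (idm x) = idm (fob x);
  fhom_comp : forall x y z (f : hom x y) (g : hom y z),
    fhom (hcomp f g) = hcomp (fhom f) (fhom g)
}.

Definition fmor (A B : groupoid) (F : gfunctor A B) (f : mor A) : mor B :=
  existT (fun xy : B * B => hom xy.1 xy.2) (F (tag f).1, F (tag f).2)
    (fhom F (tagged f)).

Definition covering (A B : groupoid) (F : gfunctor A B) :=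
  forall (f : mor B) (x1 : A), F x1 = source f ->
    exists! g : mor A, source g = x1 /\ fmor F g = f.

Definition finite_fibers (A B : groupoid) (F : gfunctor A B) :=
  forall y : B, finite_set [set x : A | F x = y].

(* Integrals depend on the order of summation prescribed by the degrees: with
   unrelated degrees on A and B, the identity functor of a set would rearrange
   conditionally convergent series. *)
Definition graded_functor (A B : groupoid) (dA : grading A) (dB : grading B)
  (F : gfunctor A B) := forall x : A, dB (F x) = dA x.

(* Functors from A to V, the latter having only identity morphisms. *)
Definition is_morphism (A : groupoid) (V : Type) (phi : A -> V) :=
  forall x y : A, hom x y -> phi x = phi y.

Definition pushforward (A B : groupoid) (V : zmodType) (F : gfunctor A B)
  (phi : A -> V) : B -> V := fun y => \sum_(x \in [set x | F x = y]) phi x.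

Section integral.
Context (C : numFieldType) (R : topComAlgType C) (V : topModType R).
Context (A : groupoid) (dA : grading A) (phi : A -> V).

Definition coarse_measure (c : coarse A) : C := (card_Aut (repr c))%:R^-1.

Definition degree_integral (n : nat) : V :=
  \sum_(c \in coarse_deg dA n) (coarse_measure c)%:A *: phi (repr c).

Definition groupoid_integrable : Prop := cvgn (series degree_integral).

(* V need not be Hausdorff; when the series has several limits, [limn] selects
   one that only depends on the sequence of its partial sums. *)
Definition groupoid_integral : V := limn (series degree_integral).

End integral.

(* Main.v *)
From Pilot Require Import Defs.
From mathcomp Require Import all_boot all_order all_algebra.
From mathcomp Require Import complex reals.
From mathcomp Require Import generic_quotient finmap.
From mathcomp Require Import boolp classical_sets cardinality fsbigop.

(** Since [pi] preserves degrees, it is enough to compare the two series term by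
    term: [degree_integral_pushforward] shows that the sums over [B_n] and over
    [A_n] are equal for every [n].  Everything then follows, because
    integrability and the integral only depend on the sequence of these sums.

    Write [|x, x'|] for the number of morphisms from [x] to [x'], let [d] range
    over representatives of the classes in [A_n], and [c] over those in [B_n].
    The proof never computes the number of objects of a fiber lying in a given
    isomorphism class; it counts morphisms instead, using three facts.

    - Expansion ([coarse_expansion]): if [x] has degree [n], then
      [phi x = sum_d |x, d| / |Aut d| * phi d], as only the class of [x]
      contributes, with coefficient [1].  The same holds on [B].
    - Unique lifting ([nhom_covering]): the morphisms from [pi x] to [y] are the
      images of the morphisms from [x] to the points of the fiber over [y], so
      [|pi x, y|] is the sum of [|x, x'|] over that fiber.
    - [|x, y|] is symmetric, and invariant under isomorphisms of [y].

    Summing the expansion of [phi] over the fiber of [y] gives, by unique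
    lifting, the formula of [pushforward_expansion],
    [pi_* phi y = sum_d |pi d, y| / |Aut d| * phi d], which only depends on the
    isomorphism class of [y]: the push-forward is a morphism.  Dividing by
    [|Aut c|] at [y = c], summing over [c] and exchanging the sums yields
    [sum_d 1 / |Aut d| * (sum_c |pi d, c| / |Aut c| * phi d)], where the inner
    sum is [phi d], by the expansion on [B] of a constant function. *)

(* The last import makes [hom] stand for the morphisms of a groupoid again, a
   name that the linear algebra of vector spaces also uses. *)
Import GRing.Theory Num.Theory Pilot.Defs.

Local Open Scope ring_scope.
Local Open Scope complex_scope.
Local Open Scope classical_set_scope.

Set Implicit Arguments.
Unset Strict Implicit.

Lemma fsbig_only (R : Type) (idx : R) (op : Monoid.com_law idx)
    (I : choiceType) (P : set I) (i : I) (f : I -> R) :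
  P i -> (forall j, P j -> j <> i -> f j = idx) ->
  \big[op/idx]_(j \in P) f j = f i.
Proof.
move=> Pi f0; rewrite -[RHS](fsbig_set1 op i f); apply/esym/fsbig_widen.
- by move=> _ ->.
- by move=> j [Pj ji]; apply: f0.
Qed.

Arguments fsbig_only {R idx op I P} i {f}.

(** Comparing morphisms in the total type [mor A] avoids transporting them along
    equalities between their targets. *)
Definition mkmor (A : groupoid) (x y : A) (f : hom x y) : mor A :=
  existT (fun xy : A * A => hom xy.1 xy.2) (x, y) f.

Lemma mkmor_inj (A : groupoid) (x y : A) : injective (@mkmor A x y).
Proof. by move=> f g e; apply: (eq_from_Tagged e). Qed.

Section NumberOfMorphisms.
Context (A : groupoid).
Implicit Types x y z : A.

Definition nhom x y : nat := (\sum_(f \in [set: hom x y]) 1)%N.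

Lemma nhomxx x : finite_homs A -> nhom x x = card_Aut x.
Proof.
move=> hA; rewrite /nhom fsbig_finite; last exact: hA.
by rewrite sum1_size.
Qed.

Lemma nhom_sym x y : nhom x y = nhom y x.
Proof.
have hinvK u v (f : hom u v) : hinv (hinv f) = f.
  by rewrite -[LHS]hcomp_idl -(hcomp_invr f) -hcompA hcomp_invr hcomp_idr.
rewrite /nhom (reindex_fsbigT (@hinv A y x))//.
by exists (@hinv A x y).
Qed.

Lemma nhom_isor x y z (g : hom y z) : nhom x y = nhom x z.
Proof.
rewrite /nhom (reindex_fsbigT (fun f : hom x y => hcomp f g))//.
exists (fun f => hcomp f (hinv g)) => f.
- by rewrite -hcompA hcomp_invr hcomp_idr.
- by rewrite -hcompA hcomp_invl hcomp_idr.
Qed.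

Lemma nhom_eq0 x y : ~ inhabited (hom x y) -> nhom x y = 0%N.
Proof. by move=> xy; rewrite /nhom fsbig1// => f _; case: xy; exists. Qed.

Lemma finite_hom x y : finite_homs A -> finite_set [set: hom x y].
Proof.
move=> hA; have [[g]|xy] := pselect (inhabited (hom x y)); last first.
  by rewrite (_ : [set: _] = set0)//; apply/seteqP; split=> // f; case: xy; exists.
rewrite (_ : [set: _] = (fun f : hom x x => hcomp f g) @` [set: hom x x])%classic.
  exact/finite_image/hA.
apply/seteqP; split=> // f _; exists (hcomp f (hinv g)) => //.
by rewrite -hcompA hcomp_invl hcomp_idr.
Qed.

Lemma card_Aut_gt0 x : finite_homs A -> (0 < card_Aut x)%N.
Proof.
move=> hA; rewrite cardfs_gt0; apply/fset0Pn; exists (idm x).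
by rewrite in_fset_set ?inE; last exact: hA.
Qed.

Lemma inhabited_hom_repr x (c : coarse A) :
  inhabited (hom x (repr c)) <-> c = \pi_(coarse A)%qT x.
Proof.
split=> [xc|->].
  rewrite -[c]reprK; apply/eqmodP; rewrite /= isomorphic_sym.
  exact/asboolP.
have : \pi_(coarse A)%qT x = \pi_(coarse A)%qT (repr (\pi_(coarse A)%qT x)).
  by rewrite reprK.
by move=> /eqmodP /asboolP.
Qed.

End NumberOfMorphisms.

Section Covering.
Context (A B : groupoid) (F : gfunctor A B).
Hypothesis hcov : covering F.

Lemma covering_lift (x : A) (y : B) (h : hom (F x) y) :
  exists x' (g : hom x x'), mkmor (fhom F g) = mkmor h.
Proof.
have [[[x1 x'] g] [[/= e <-] _]] := @hcov (mkmor h) x erefl.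
by rewrite /source/= in e; subst x1; exists x', g.
Qed.

Lemma covering_inj (x x1 x2 : A) (g1 : hom x x1) (g2 : hom x x2) :
  mkmor (fhom F g1) = mkmor (fhom F g2) -> mkmor g1 = mkmor g2.
Proof.
move=> e; have [g [_ gP]] := @hcov (mkmor (fhom F g1)) x erefl.
by rewrite -(gP (mkmor g1))// -(gP (mkmor g2)).
Qed.

(** Unique lifting, in the form of a count.  Both sides are the sum, over all
    [h : F x -> y] and all [x'] over [y], of [1] when [h] lifts to a morphism
    [x -> x'] and [0] otherwise: a given [h] lifts for exactly one [x'], and for
    a given [x'] the functor is a bijection from the morphisms [x -> x'] to the
    [h] that lift. *)
Lemma nhom_covering (x : A) (y : B) : finite_homs B -> finite_fibers F ->
  nhom (F x) y = (\sum_(x' \in [set x' | F x' = y]) nhom x x')%N.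
Proof.
move=> hB hfin.
pose L (h : hom (F x) y) x' :=
  `[< exists g : hom x x', mkmor (fhom F g) = mkmor h >].
transitivity (\sum_(h \in [set: hom (F x) y])
    \sum_(x' \in [set x' | F x' = y]) (L h x' : nat))%N.
  apply: eq_fsbigr => h _; have [x' [g gh]] := covering_lift h.
  have Lx' : L h x' by apply/asboolP; exists g.
  rewrite (fsbig_only x') ?Lx'//=; first by have [] := congr1 tag gh.
  move=> x'' _ ne; have [/asboolP[g' g'h]|] // := boolP (L h x'').
  have /(congr1 tag)[e] : mkmor g' = mkmor g by apply: covering_inj; rewrite gh.
  by case: ne.
rewrite exchange_fsbig//; last exact: finite_hom.
apply: eq_fsbigr => x'; rewrite inE/= => e; subst y.
rewrite [RHS](eq_fsbigr (fun g : hom x x' => L (fhom F g) x' : nat)); last first.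
  by move=> g _; rewrite (_ : L _ _)//; apply/asboolP; exists g.
rewrite -(fsbig_image [set: hom x x'] (@fhom _ _ F x x')
  (fun h => L h x' : nat)); last first.
  by move=> g1 g2 _ _ e; apply/mkmor_inj/covering_inj; rewrite e.
apply/esym/fsbig_widen => // h [_ nh]; rewrite /preimage/=.
have [/asboolP[g gh]|//] := boolP (L h x').
by case: nh; exists g => //; apply: mkmor_inj.
Qed.

End Covering.

Section ScalarSums.
Context (C : numFieldType) (R : topComAlgType C) (V : topModType R).

Lemma scaler_algA (a b : C) (v : V) :
  a%:A *: (b%:A *: v : V) = (a * b)%:A *: v.
Proof. by rewrite scalerA -scalerAl mul1r [a *: _]scalerA. Qed.

Lemma fsum_scaler (I : choiceType) (P : set I) (a : C) (f : I -> V) :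
  finite_set P ->
  \sum_(i \in P) (a%:A *: f i : V) = a%:A *: (\sum_(i \in P) f i).
Proof. by move=> fP; rewrite !fsbig_finite// scaler_sumr. Qed.

Lemma fsum_natr_scaler (I : choiceType) (P : set I) (m : I -> nat) (a : C)
    (v : V) : finite_set P ->
  \sum_(i \in P) (((m i)%:R * a)%:A *: v : V)
    = (((\sum_(i \in P) m i)%N)%:R * a)%:A *: v.
Proof.
by move=> fP; rewrite !fsbig_finite// natr_sum mulr_suml !scaler_suml.
Qed.

(** Only the class [c] of [x] admits morphisms from [x], and it contributes
    [phi (repr c) = phi x], as there are as many morphisms from [x] to [repr c]
    as automorphisms of [repr c].  Using these coefficients rather than an
    indicator function lets them be added over a fiber of a covering. *)
Lemma coarse_expansion (A : groupoid) (dA : grading A) (phi : A -> V) (x : A) :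
  finite_homs A -> is_morphism phi ->
  \sum_(c \in coarse_deg dA (dA x))
    (((nhom x (repr c))%:R * coarse_measure C c)%:A *: phi (repr c) : V)
  = phi x.
Proof.
move=> hA hphi; set c := \pi_(coarse A)%qT x.
have [g] : inhabited (hom x (repr c)) by apply/inhabited_hom_repr.
rewrite (fsbig_only c); last 2 first.
- exact/esym/(degree_hom dA g).
- move=> j _ jc; rewrite nhom_eq0 ?mul0r ?scale0r//.
  by move=> /inhabited_hom_repr.
rewrite -(hphi _ _ g).
rewrite nhom_sym (nhom_isor _ g) nhomxx//.
rewrite /coarse_measure mulfV ?scale1r//.
by rewrite pnatr_eq0 -lt0n card_Aut_gt0.
Qed.

End ScalarSums.

Section Pushforward.
Context (C : numFieldType) (R : topComAlgType C) (V : topModType R).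
Context (A B : groupoid) (dA : grading A) (dB : grading B).
Hypotheses (hA : finite_homs A) (hB : finite_homs B).
Context (F : gfunctor A B).
Hypotheses (hgr : graded_functor dA dB F) (hcov : covering F).
Hypothesis hfin : finite_fibers F.
Context (phi : A -> V).
Hypothesis hphi : is_morphism phi.

(** The sum over the fiber of [y] becomes a sum over classes of objects of [A],
    with coefficients that visibly depend only on the isomorphism class of
    [y]. *)
Lemma pushforward_expansion (y : B) :
  pushforward F phi y = \sum_(d \in coarse_deg dA (dB y))
    (((nhom (F (repr d)) y)%:R * coarse_measure C d)%:A *: phi (repr d) : V).
Proof.
transitivity (\sum_(x \in [set x | F x = y]) \sum_(d \in coarse_deg dA (dB y))
    (((nhom x (repr d))%:R * coarse_measure C d)%:A *: phi (repr d) : V)).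
  apply: eq_fsbigr => x; rewrite inE/= => <-; rewrite hgr.
  exact/esym/coarse_expansion.
rewrite exchange_fsbig//; last exact: coarse_finite.
apply: eq_fsbigr => d _; rewrite fsum_natr_scaler// nhom_covering//.
by congr ((_%:R * _)%:A *: _); apply: eq_fsbigr => x _; rewrite nhom_sym.
Qed.

Lemma pushforward_is_morphism : is_morphism (pushforward F phi).
Proof.
move=> y y' h; rewrite !pushforward_expansion (degree_hom dB h).
by apply: eq_fsbigr => d _; rewrite (nhom_isor _ h).
Qed.

Lemma degree_integral_pushforward :
  degree_integral dB (pushforward F phi) = degree_integral dA phi.
Proof.
apply/funext => n; rewrite /degree_integral.
transitivity (\sum_(c \in coarse_deg dB n) \sum_(d \in coarse_deg dA n)
   ((coarse_measure C d)%:A *: (((nhom (F (repr d)) (repr c))%:R *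
      coarse_measure C c)%:A *: phi (repr d)) : V)).
  apply: eq_fsbigr => c; rewrite inE/= => cn.
  rewrite pushforward_expansion cn -fsum_scaler; last exact: coarse_finite.
  apply: eq_fsbigr => d _; rewrite !scaler_algA.
  by congr (_%:A *: _); rewrite mulrA mulrC [_ * (_%:R)]mulrC.
rewrite exchange_fsbig; try exact: coarse_finite.
(* For a fixed [d], what remains is the expansion at [F (repr d)] of the function
   on [B] with constant value [phi (repr d)]. *)
apply: eq_fsbigr => d; rewrite inE/= => dn.
rewrite fsum_scaler; last exact: coarse_finite.
congr (_ *: _).
by have := @coarse_expansion C R V B dB (fun=> phi (repr d)) (F (repr d)) hB;
  rewrite hgr dn; apply.
Qed.

End Pushforward.

Theorem proposition3p2 (K : realType) (R : topComAlgType K[i])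
    (V : topModType R) (A B : groupoid) (dA : grading A) (dB : grading B)
    (hA : finite_homs A) (hB : finite_homs B)
    (F : gfunctor A B) (hgr : graded_functor dA dB F)
    (hcov : covering F) (hfin : finite_fibers F)
    (phi : A -> V) (hphi : is_morphism phi)
    (hint : groupoid_integrable dA phi) :
  [/\ is_morphism (pushforward F phi),
      groupoid_integrable dB (pushforward F phi) &
      groupoid_integral dB (pushforward F phi) = groupoid_integral dA phi].
Proof.
rewrite /groupoid_integrable /groupoid_integral.
rewrite (degree_integral_pushforward hA hB hgr hcov hfin hphi).
split=> //; exact: (pushforward_is_morphism hA hB hgr hcov hfin hphi).
Qed.
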